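(* For every odd integer $m \ge 5$, the graph $G_m$ is maximal triangle-free.
   Context: All graphs are finite and simple. A graph is triangle-free if it contains no cycle of length three; a triangle-free graph is maximal triangle-free if adding any new edge between two distinct non-adjacent vertices creates a triangle. Let $m \ge 5$ be an odd integer and $n = 2m+1$. The graph $G_m$ has as vertex set the $n$ distinct vertices $a_n$, $p_1,\dots,p_m$, $q_1,\dots,q_m$. All indices of $p$ and $q$ are taken modulo $m$ with representatives in $\{1,\dots,m\}$ (so $q_0 = q_m$, $p_{m+1}=p_1$, $q_{m+1} = q_1$, etc.). The (undirected) edges of $G_m$ are: (1) $a_n q_i$ for $1 \le i \le m$; (2) $p_i p_{i+1}$ for $1 \le i \le m$; (3) $p_i q_{i+(2k-1)}$ for $1 \le i \le m$ and all integers $k$ with $0 \le k \le \frac{m-3}{2}$. There are no other edges. *)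

(* Defs.v *)
From HB Require Import structures.
From mathcomp Require Import all_boot all_order all_algebra.

Set Implicit Arguments.
Unset Strict Implicit.
Unset Printing Implicit Defensive.

Record sgraph := SGraph {
  svertex :> finType;
  sedge : rel svertex;
  sedge_sym : symmetric sedge;
  sedge_irrefl : irreflexive sedge
}.

Definition has_triangle (G : sgraph) : Prop :=
  exists2 c : seq G, ucycle (@sedge G) c & size c = 3.

Definition triangle_free (G : sgraph) : Prop := ~ has_triangle G.

Section AddEdge.
Variables (G : sgraph) (x y : G) (xy : x != y).

Definition add_edge_rel : rel G := fun u v =>
  [|| sedge u v, (u == x) && (v == y) | (u == y) && (v == x)].

Lemma add_edge_sym : symmetric add_edge_rel.
Proof.
move=> u v; rewrite /add_edge_rel sedge_sym; congr (_ || _).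
by rewrite orbC ![(v == _) && _]andbC.
Qed.

Lemma add_edge_irrefl : irreflexive add_edge_rel.
Proof.
move=> u; rewrite /add_edge_rel sedge_irrefl /= [(u == y) && _]andbC orbb.
apply/negbTE/andP => -[/eqP uy /eqP ux]; by move: xy; rewrite -ux -uy eqxx.
Qed.

Definition add_edge : sgraph := SGraph add_edge_sym add_edge_irrefl.
End AddEdge.

Definition maximal_triangle_free (G : sgraph) : Prop :=
  triangle_free G /\
  forall (x y : G) (xy : x != y), ~~ sedge x y -> has_triangle (add_edge xy).

(* An index is represented by its residue modulo m, so that p_m and q_m are  *)
(* the vertices Vp 0 and Vq 0.                                               *)
Inductive Gm_vertex (m : nat) : Type :=
  | Va
  | Vp of 'I_m
  | Vq of 'I_m.
Arguments Va {m}.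

Section VertexFinType.
Variable m : nat.

Definition Gm_vertex_code (v : Gm_vertex m) : option ('I_m + 'I_m) :=
  match v with
  | Va => None
  | Vp i => Some (inl i)
  | Vq i => Some (inr i)
  end.

Definition Gm_vertex_decode (c : option ('I_m + 'I_m)) : Gm_vertex m :=
  match c with
  | None => Va
  | Some (inl i) => Vp i
  | Some (inr i) => Vq i
  end.

Lemma Gm_vertex_codeK : cancel Gm_vertex_code Gm_vertex_decode.
Proof. by case. Qed.

HB.instance Definition _ := Finite.copy (Gm_vertex m)
  (can_type Gm_vertex_codeK).

Lemma card_Gm_vertex : #|{: Gm_vertex m}| = (2 * m).+1.
Proof.
have codeK' : cancel Gm_vertex_decode Gm_vertex_code by case=> [[]|].
rewrite (bij_eq_card (Bijective Gm_vertex_codeK codeK')).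
by rewrite card_option card_sum card_ord mul2n addnn.
Qed.
End VertexFinType.

(* Each edge is listed in one orientation only. The congruence is taken in   *)
(* int because the shift 2k - 1 is -1 at k = 0.                              *)
Definition Gm_arc (m : nat) (u v : Gm_vertex m) : bool :=
  match u, v with
  | Va, Vq _ => true
  | Vp i, Vp j => j == i.+1 %[mod m]
  | Vp i, Vq j =>
      [exists k : 'I_((m - 3) %/ 2).+1,
         (j%:Z == i%:Z + (2%:Z * k%:Z - 1) %[mod m%:Z])%Z]
  | _, _ => false
  end.

Definition Gm_edge (m : nat) : rel (Gm_vertex m) :=
  fun u v => Gm_arc u v || Gm_arc v u.

Lemma Gm_edge_sym (m : nat) : symmetric (@Gm_edge m).
Proof. by move=> u v; rewrite /Gm_edge orbC. Qed.

Lemma Gm_edge_irrefl (m : nat) : 5 <= m -> irreflexive (@Gm_edge m).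
Proof.
move=> m_ge5 [|i|i] //; rewrite /Gm_edge /= orbb.
rewrite -addn1 -{1}[nat_of_ord i]addn0 eqn_modDl mod0n modn_small //.
exact: leq_trans m_ge5.
Qed.

Definition Gm (m : nat) (m_ge5 : 5 <= m) : sgraph :=
  SGraph (@Gm_edge_sym m) (Gm_edge_irrefl m_ge5).

(* Main.v *)
Require Import Defs.
From mathcomp Require Import all_boot all_order all_algebra.
From mathcomp Require Import zify.

(** Everything reduces to arithmetic of the cyclic offset d = j - i mod m in
    [0, m).  The vertex p_i is adjacent to q_j exactly when d lies in
    S = {1, 3, ..., m - 4} U {m - 1}.

    No triangle: p_1, ..., p_m span a cycle of length m >= 5, and the q_j are
    independent and carry all the neighbours of a_n.  So a triangle would be
    p_i, p_{i+1}, q_j, which needs d and d - 1 both in S, the difference being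
    taken modulo m.  But no two cyclically consecutive residues lie in S: its
    elements are odd except for m - 1, whose neighbours m - 2 and 0 are
    missing.

    Maximality amounts to a common neighbour for every nonadjacent pair.
    - q_i and q_j share a_n; a_n and p_i share q_{i+1}.
    - If p_i and q_j are nonadjacent then d is m - 2 or even and at most m - 3,
      so that d + 1 or d - 1 is in S: the common neighbour is p_{i-1} or
      p_{i+1}.
    - For p_i and p_j nonadjacent, m being odd, one of the two offsets j - i
      and i - j is even; say d = j - i, in {2, 4, ..., m - 3}.  Then q_{j-1}
      is at offset -1 from p_j and at the odd offset d - 1 <= m - 4 from p_i,
      hence adjacent to both. *)

Lemma has_triangleP (G : sgraph) :
  has_triangle G <->
  exists x y z : G, [/\ sedge x y, sedge y z & sedge z x].
Proof.
split=> [[[|x [|y [|z [|? ?]]]] // /andP[/and4P[xy yz zx _] _] _]|].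
  by exists x, y, z.
move=> [x [y [z [xy yz zx]]]]; exists [:: x; y; z] => //.
rewrite /ucycle /= xy yz zx /= !inE.
have neq (u v : G) : sedge u v -> u == v = false.
  by apply: contraTF => /eqP ->; rewrite sedge_irrefl.
by rewrite (neq _ _ xy) (neq _ _ yz) [x == z]eq_sym (neq _ _ zx).
Qed.

Lemma has_triangle_add_edge (G : sgraph) (x y z : G) (xy : x != y) :
  sedge x z -> sedge y z -> has_triangle (add_edge xy).
Proof.
move=> xz yz; apply/has_triangleP; exists x, y, z.
by rewrite /= /add_edge_rel !eqxx yz [sedge z x]sedge_sym xz !orbT.
Qed.

(** The residue of j - i modulo m for i, j < m, written without division so
    that linear arithmetic can decide statements about it. *)
Definition offset (m i j : nat) : nat := if i <= j then j - i else m - (i - j).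

(** The offsets from p_i of its neighbours among the q_j. *)
Definition pq_offset (m d : nat) : bool := (d == m - 1) || odd d && (d <= m - 4).

Section EdgesOfGm.
Variable m : nat.
Hypotheses (m_ge5 : 5 <= m) (m_odd : odd m).

Local Notation edge := (@Gm_edge m).

Lemma edge_pp (i j : 'I_m) :
  edge (Vp i) (Vp j) = (offset m i j == 1) || (offset m i j == m - 1).
Proof.
have succ_mod (k l : 'I_m) :
    (l == k.+1 %[mod m]) = (l == k.+1 :> nat) || (k.+1 == m) && (l == 0 :> nat).
  rewrite [l %% m]modn_small //; have := ltn_ord k; rewrite leq_eqVlt.
  case/orP=> [/eqP km|km]; first by rewrite km modnn; have := ltn_ord l; lia.
  by rewrite modn_small //; lia.
rewrite /Gm_edge /= !succ_mod /offset.
by have := ltn_ord i; have := ltn_ord j; case: ifP; lia.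
Qed.

Lemma edge_pq (i j : 'I_m) : edge (Vp i) (Vq j) = pq_offset m (offset m i j).
Proof.
rewrite /Gm_edge /= orbF /pq_offset /offset.
have ltim := ltn_ord i; have ltjm := ltn_ord j.
apply/existsP/idP => [[k]|].
  have ltk := ltn_ord k.
  rewrite eqz_mod_dvd => /dvdzP[c Dc].
  (* The difference j - i - (2k - 1) lies strictly above -2m and at most at m. *)
  have : (c = -1 \/ c = 0 \/ c = 1)%R by nia.
  by case=> [|[]] c_val; rewrite c_val in Dc; case: ifP; lia.
move=> d_adj.
(* An odd offset d is 2k - 1 for k = (d + 1) / 2; the even one, m - 1, is -1
   modulo m, which comes from k = 0. *)
have lt_k : (if odd (offset m i j) then (offset m i j).+1 %/ 2 else 0)
            < ((m - 3) %/ 2).+1.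
  by move: d_adj; rewrite /pq_offset /offset; case: ifP; case: ifP; lia.
exists (Ordinal lt_k); rewrite eqz_mod_dvd /=; apply/dvdzP.
move: d_adj {lt_k}; rewrite /pq_offset /offset.
case: (leqP i j) => [le_ij|lt_ji] d_adj; case: ifP => d_odd.
- by exists 0%R; lia.
- by exists 1%R; lia.
- by exists (-1)%R; lia.
- by exists 0%R; lia.
Qed.

Lemma edge_qp (i j : 'I_m) : edge (Vq j) (Vp i) = pq_offset m (offset m i j).
Proof. by rewrite Gm_edge_sym edge_pq. Qed.

Let edgeE := (edge_pp, edge_pq, edge_qp).

(** Adjacent p-vertices are at cyclically consecutive offsets from q_k, and no
    two cyclically consecutive residues satisfy [pq_offset m]. *)
Lemma no_ppq_triangle (i j k : 'I_m) :
  edge (Vp i) (Vp j) -> edge (Vp i) (Vq k) -> edge (Vp j) (Vq k) -> False.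
Proof.
rewrite !edgeE /pq_offset /offset.
have := ltn_ord i; have := ltn_ord j; have := ltn_ord k.
by case: (leqP i j); case: (leqP i k); case: (leqP j k); lia.
Qed.

Lemma no_ppp_triangle (i j k : 'I_m) :
  edge (Vp i) (Vp j) -> edge (Vp j) (Vp k) -> edge (Vp k) (Vp i) -> False.
Proof.
rewrite !edgeE /offset.
have := ltn_ord i; have := ltn_ord j; have := ltn_ord k.
by case: (leqP i j); case: (leqP j k); case: (leqP k i); lia.
Qed.

Lemma Gm_no_triangle (x y z : Gm_vertex m) :
  edge x y -> edge y z -> edge z x -> False.
Proof.
case: x y z => [|i|i] [|j|j] [|k|k] //.
- exact: no_ppp_triangle.
- by move=> ij jk; rewrite Gm_edge_sym => ik; apply: (no_ppq_triangle i j k).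
- by move=> ij; rewrite Gm_edge_sym => kj ki; apply: (no_ppq_triangle k i j).
- by rewrite Gm_edge_sym => ji jk ki; apply: (no_ppq_triangle j k i).
Qed.

(** All common neighbours other than a_n are obtained by moving one index a
    single step around the cycle, forwards here and backwards in
    [offset_pred]. *)
Lemma offset_succ (i : 'I_m) : exists j : 'I_m, offset m i j = 1.
Proof.
have lt_s : (if i.+1 == m then 0 else i.+1) < m.
  by have := ltn_ord i; case: ifP; lia.
by exists (Ordinal lt_s); rewrite /offset /=; have := ltn_ord i; do 2!case: ifP; lia.
Qed.

Lemma offset_pred (i : 'I_m) : exists j : 'I_m, offset m i j = m - 1.
Proof.
have lt_p : (if i == 0 :> nat then m.-1 else i.-1) < m.
  by have := ltn_ord i; case: ifP; lia.
by exists (Ordinal lt_p); rewrite /offset /=; have := ltn_ord i; do 2!case: ifP; lia.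
Qed.

(** A forbidden offset d is m - 2, next to the allowed m - 1, or else it is
    even and d - 1 is allowed, with 0 - 1 read as m - 1. *)
Lemma common_neighbour_pq (i j : 'I_m) :
  ~~ edge (Vp i) (Vq j) -> exists2 z, edge (Vp i) z & edge (Vq j) z.
Proof.
have ltim := ltn_ord i; have ltjm := ltn_ord j.
rewrite edgeE => d_nadj.
have [d_m2|d_m2] := eqVneq (offset m i j) (m - 2).
  have [k Dk] := offset_pred i; exists (Vp k); rewrite !edgeE ?Dk ?eqxx ?orbT //.
  have ltkm := ltn_ord k; move: d_nadj d_m2 Dk; rewrite /pq_offset /offset.
  by case: (leqP i j); case: (leqP i k); case: (leqP k j); lia.
have [k Dk] := offset_succ i; exists (Vp k); rewrite !edgeE ?Dk //.
have ltkm := ltn_ord k; move: d_nadj d_m2 Dk; rewrite /pq_offset /offset.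
by case: (leqP i j); case: (leqP i k); case: (leqP k j); lia.
Qed.

(** The offsets from p_i to p_j and back sum to the odd m, so one of them is
    even; the symmetry of the statement lets it be the first, d.  As p_i and
    p_j are distinct and nonadjacent, 2 <= d <= m - 3, and q_{j-1} is at
    offset m - 1 from p_j and d - 1 from p_i. *)
Lemma common_neighbour_pp (i j : 'I_m) :
  i != j -> ~~ edge (Vp i) (Vp j) -> exists2 z, edge (Vp i) z & edge (Vp j) z.
Proof.
wlog d_even : i j / ~~ odd (offset m i j) => [even_case|] neq_ij.
  have [d_odd|d_even] := boolP (odd (offset m i j)); last exact: even_case.
  rewrite Gm_edge_sym => nadj.
  case: (even_case j i) => [||//|z]; last by exists z.
  - have := ltn_ord i; have := ltn_ord j; move: d_odd neq_ij.
    by rewrite -val_eqE /offset /=; case: (leqP i j); case: (leqP j i); lia.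
  - by rewrite eq_sym.
rewrite edgeE => nadj; have [k Dk] := offset_pred j.
exists (Vq k); rewrite !edgeE /pq_offset ?Dk ?eqxx //.
have := ltn_ord i; have := ltn_ord j; have := ltn_ord k.
move: d_even neq_ij nadj Dk; rewrite -val_eqE /offset /=.
by case: (leqP i j); case: (leqP j k); case: (leqP i k); lia.
Qed.

Lemma common_neighbour_ap (i : 'I_m) : exists2 z, edge Va z & edge (Vp i) z.
Proof.
have [k Dk] := offset_succ i; exists (Vq k) => //.
by rewrite edgeE Dk /pq_offset; lia.
Qed.

Lemma Gm_common_neighbour (x y : Gm_vertex m) :
  x != y -> ~~ edge x y -> exists2 z, edge x z & edge y z.
Proof.
case: x y => [|i|i] [|j|j] // neq_xy nadj.
- exact: common_neighbour_ap.
- by have [z] := common_neighbour_ap i; exists z.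
- by apply: common_neighbour_pp nadj; apply: contraNneq neq_xy => ->.
- exact: common_neighbour_pq.
- rewrite Gm_edge_sym in nadj.
  by have [z] := common_neighbour_pq _ _ nadj; exists z.
- by exists Va.
Qed.

End EdgesOfGm.

Theorem lemma4p4 (m : nat) (m_ge5 : 5 <= m) (m_odd : odd m) :
  maximal_triangle_free (Gm m_ge5).
Proof.
split=> [/has_triangleP[x [y [z [xy yz zx]]]]|x y xy nadj].
  exact: (Gm_no_triangle m m_ge5 m_odd x y z).
have [z xz yz] := Gm_common_neighbour m m_ge5 m_odd x y xy nadj.
exact: (@has_triangle_add_edge (Gm m_ge5) x y z xy xz yz).
Qed.
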